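(* Let $X,Y$ be nonempty sets, let $\Phi:X\times Y\to[0,\infty)$, and for each $x\in X$ let $y(x)\in Y$ satisfy $\Phi(x,y)\ge\Phi(x,y(x))$ for all $y\in Y$. Let $\{x^k\},\{y^k\}$ be generated by alternating minimization and suppose the weak three-point property holds: for all $x\in X$ and all $k$, $$\Phi(x,y^k)-\Phi(x^k,y^{k+1})\ge d(x,x^k),$$ where $d(x,z):=\Phi(x,y(z))-\Phi(x,y(x))$ for $x,z\in X$. Then, with $f(x):=\Phi(x,y(x))$, $$d(x,x^{k-1})+f(x)\ge d(x,x^k)+f(x^k)$$ for all $x\in X$ and all $k$ (so the algorithm is in the SUMMA2 class), and the decreasing sequence $\{\Phi(x^k,y^{k+1})\}=\{f(x^k)\}$ converges to $\beta:=\inf_{x\in X,\,y\in Y}\Phi(x,y)$.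
   Context: Alternating minimization: for each $k$, $x^k$ is a minimizer over $x\in X$ of $\Phi(x,y^k)$, and $y^{k+1}:=y(x^k)$, a minimizer over $y\in Y$ of $\Phi(x^k,y)$; thus $y^k=y(x^{k-1})$ and $\Phi(x^k,y^{k+1})=f(x^k)$. An iterative algorithm for minimizing $f:X\to\mathbb{R}$ is in the SUMMA2 class if, for each sequence $\{x^k\}$ it generates, there are functions $h_k:X\to[0,\infty)$ with $h_k(x)+f(x)\ge h_{k+1}(x)+f(x^k)$ for all $x\in X$ and all $k$; here one has $h_k(x)=d(x,x^{k-1})$. *)

(* Defs.v *)
From HB Require Import structures.
From mathcomp Require Import all_boot all_order all_algebra.
From mathcomp Require Import all_classical all_reals all_analysis.
Set Implicit Arguments.
Unset Strict Implicit.
Unset Printing Implicit Defensive.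
Import Order.TTheory GRing.Theory Num.Theory.
Import numFieldNormedType.Exports.
Local Open Scope classical_set_scope.
Local Open Scope ring_scope.

Definition is_minimizer (R : realType) (T : Type) (g : T -> R) (t : T) : Prop :=
  forall s, g t <= g s.

Section AlternatingMinimization.
Variables (R : realType) (X Y : Type) (Phi : X -> Y -> R) (ymin : X -> Y).

Definition AM_objective (x : X) : R := Phi x (ymin x).

Definition AM_dist (x z : X) : R := Phi x (ymin z) - Phi x (ymin x).

(* The iteration starts from an arbitrary x 0, then y 1 = ymin (x 0), x 1, and
   so on, so that y k = ymin (x k.-1) for every k >= 1; the value y 0 plays no
   role. A run started from some y 0 instead also satisfies these conditions. *)
Definition alternating_minimization (x : nat -> X) (y : nat -> Y) : Prop :=
  (forall k, y k.+1 = ymin (x k)) /\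
  (forall k, (0 < k)%N -> is_minimizer (fun z => Phi z (y k)) (x k)).

Definition weak_three_point_property (x : nat -> X) (y : nat -> Y) : Prop :=
  forall k z, (0 < k)%N -> Phi z (y k) - Phi (x k) (y k.+1) >= AM_dist z (x k).

End AlternatingMinimization.

Section SUMMA2.
Variables (R : realType) (X : Type) (f : X -> R).

Definition SUMMA2_certificate (x : nat -> X) (h : nat -> X -> R) : Prop :=
  (forall k z, 0 <= h k z) /\
  (forall k z, (0 < k)%N -> h k z + f z >= h k.+1 z + f (x k)).

(* An iterative algorithm is represented by the set of sequences it can
   generate. *)
Definition SUMMA2_class (A : set (nat -> X)) : Prop :=
  forall x, A x -> exists h, SUMMA2_certificate x h.

End SUMMA2.

(* Main.v *)
(** Since [y k = ymin (x k.-1)], the weak three-point property is the SUMMA2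
    inequality with [h k = d (.) (x k.-1)].  Along a SUMMA2 run, if [f (x k)]
    stayed above [f z + e] for some [z] and [e > 0], each step would lower the
    nonnegative number [h k z] by at least [e], which is impossible; hence the
    values of [f] come arbitrarily close to [f z] or go below it. *)

Require Import Defs.
From HB Require Import structures.
From mathcomp Require Import all_boot all_order all_algebra.
From mathcomp Require Import all_classical all_reals all_analysis.
From mathcomp Require Import lra.
Import Order.TTheory GRing.Theory Num.Theory.
Import numFieldNormedType.Exports.
Local Open Scope classical_set_scope.
Local Open Scope ring_scope.

Lemma SUMMA2_certificate_lt (R : realType) (X : Type) (f : X -> R)
    (x : nat -> X) (h : nat -> X -> R) (z : X) (e : R) :
  SUMMA2_certificate f x h -> 0 < e -> exists k, f (x k) < f z + e.
Proof.
move=> [h_ge0 h_le] e_gt0; apply: contrapT => /forallNP f_ge.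
(* The decrements telescope from [h 1], as the inequality of the certificate starts at index 1. *)
have h_decr k : h k.+1 z + e *+ k <= h 1%N z.
  elim: k => [|k IHk]; first by rewrite mulr0n addr0.
  have /negP := f_ge k.+1; rewrite -leNgt => fz_le.
  have := h_le k.+1 z isT; rewrite mulrS; lra.
(* By the Archimedean property, [n] decrements of size [e] exceed [h 1 z], so [h n.+1 z] would be
   negative. *)
pose n := Num.bound (h 1%N z / e).
have : h 1%N z < e *+ n.
  rewrite -mulr_natr mulrC -ltr_pdivrMr //.
  exact: archi_boundP (divr_ge0 (h_ge0 _ _) (ltW e_gt0)).
have := h_decr n; have := h_ge0 n.+1 z; lra.
Qed.

(** Monotone convergence already gives the limit [inf (range (f \o x))]; the certificate serves to
    identify it with the infimum over all of [X]. *)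
Lemma SUMMA2_certificate_cvg (R : realType) (X : Type) (f : X -> R)
    (x : nat -> X) (h : nat -> X -> R) :
  SUMMA2_certificate f x h -> has_lbound (range f) ->
  nonincreasing_seq (f \o x) -> f \o x @ \oo --> inf (range f).
Proof.
move=> fh [m fm] fx_noninc.
have lb_f : has_lbound (range f) by exists m.
have sub_fx : range (f \o x) `<=` range f by move=> _ [k _ <-]; exists (x k).
have lb_fx : has_lbound (range (f \o x)) by exists m => r /sub_fx /fm.
suff -> : inf (range f) = inf (range (f \o x)) by exact: nonincreasing_cvgn.
have f0 : range f (f (x 0%N)) by exists (x 0%N).
have fx0 : range (f \o x) (f (x 0%N)) by exists 0%N.
apply/eqP; rewrite eq_le; apply/andP; split.
  by apply: lb_le_inf; [exists (f (x 0%N)) | move=> r /sub_fx; apply: ge_inf].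
apply: lb_le_inf; first by exists (f (x 0%N)).
(* The iterates need not reach the level [f z], only [f z + e] for each [e > 0]. *)
move=> _ [z _ <-]; apply/ler_addgt0Pr => e e_gt0.
have [k /ltW fk_le] := SUMMA2_certificate_lt _ _ _ _ _ z _ fh e_gt0.
by apply: le_trans fk_le; apply: ge_inf => //; exists k.
Qed.

(** Minimizing out [y] first loses nothing: each value of the objective is a value of [Phi], and
    each [Phi x y] lies above the objective at [x]. *)
Lemma inf_range_AM_objective (R : realType) (X Y : Type) (Phi : X -> Y -> R)
    (ymin : X -> Y) :
  [set: X] !=set0 -> has_lbound (range (fun p : X * Y => Phi p.1 p.2)) ->
  (forall x, is_minimizer (Phi x) (ymin x)) ->
  inf (range (AM_objective Phi ymin)) =
  inf (range (fun p : X * Y => Phi p.1 p.2)).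
Proof.
move=> [x0 _] lbPhi yminP.
have sub_f : range (AM_objective Phi ymin) `<=`
             range (fun p : X * Y => Phi p.1 p.2).
  by move=> _ [x _ <-]; exists (x, ymin x).
have f0 : range (AM_objective Phi ymin) (AM_objective Phi ymin x0).
  by exists x0.
have lbf : has_lbound (range (AM_objective Phi ymin)).
  by have [m Phim] := lbPhi; exists m => r /sub_f /Phim.
apply/eqP; rewrite eq_le; apply/andP; split.
  apply: lb_le_inf; first by exists (AM_objective Phi ymin x0); apply: sub_f.
  move=> _ [[x y] _ <-] /=; apply: le_trans (yminP x y).
  by apply: ge_inf => //; exists x.
apply: lb_le_inf; first by exists (AM_objective Phi ymin x0).
by move=> r /sub_f; apply: ge_inf.
Qed.

Lemma AM_SUMMA2_certificate (R : realType) (X Y : Type) (Phi : X -> Y -> R)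
    (ymin : X -> Y) (x : nat -> X) (y : nat -> Y) :
  (forall z, is_minimizer (Phi z) (ymin z)) ->
  alternating_minimization Phi ymin x y ->
  weak_three_point_property Phi ymin x y ->
  SUMMA2_certificate (AM_objective Phi ymin) x
    (fun k z => AM_dist Phi ymin z (x k.-1)).
Proof.
(* At index 0, where [0.-1 = 0], only nonnegativity is asked. *)
move=> yminP [yS _] w3pp; split=> [k z|[//|k] z _].
  by rewrite subr_ge0; apply: yminP.
have := w3pp k.+1 z isT.
(* The sum of [AM_dist] from [z] to [x k] and the objective at [z] collapses to
   [Phi z (ymin (x k))], which is [Phi z (y k.+1)]. *)
rewrite /AM_dist /AM_objective !yS /= !subrK; lra.
Qed.

Lemma AM_objective_nonincreasing (R : realType) (X Y : Type)
    (Phi : X -> Y -> R) (ymin : X -> Y) (x : nat -> X) (y : nat -> Y) :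
  (forall z, is_minimizer (Phi z) (ymin z)) ->
  alternating_minimization Phi ymin x y ->
  nonincreasing_seq (AM_objective Phi ymin \o x).
Proof.
move=> yminP [yS xP]; apply/nonincreasing_seqP => k /=.
(* The intermediate value [Phi (x k.+1) (y k.+1)] separates the two half-steps: minimization in [y],
   then in [x]. *)
apply: le_trans (yminP (x k.+1) (y k.+1)) _.
by rewrite /AM_objective -yS; apply: xP.
Qed.

Theorem mainTheorem3 (R : realType) (X Y : Type)
    (X_nonempty : [set: X] !=set0) (Y_nonempty : [set: Y] !=set0)
    (Phi : X -> Y -> R) (Phi_ge0 : forall x y, 0 <= Phi x y)
    (ymin : X -> Y) (yminP : forall x, is_minimizer (Phi x) (ymin x))
    (x : nat -> X) (y : nat -> Y)
    (xy_AM : alternating_minimization Phi ymin x y)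
    (xy_3pp : weak_three_point_property Phi ymin x y) :
  let f := AM_objective Phi ymin in
  let d := AM_dist Phi ymin in
  let beta := inf (range (fun p : X * Y => Phi p.1 p.2)) in
  [/\ (forall k z, (0 < k)%N -> d z (x k.-1) + f z >= d z (x k) + f (x k)),
      SUMMA2_certificate f x (fun k z => d z (x k.-1))
        /\ SUMMA2_class f [set u | exists v : nat -> Y,
             alternating_minimization Phi ymin u v
             /\ weak_three_point_property Phi ymin u v],
      (forall k, Phi (x k) (y k.+1) = f (x k)),
      nonincreasing_seq (fun k => Phi (x k) (y k.+1)) &
      (fun k => Phi (x k) (y k.+1)) @ \oo --> beta].
Proof.
move=> f d beta.
have fh := AM_SUMMA2_certificate _ _ _ _ _ _ _ yminP xy_AM xy_3pp.
have fxE : (fun k => Phi (x k) (y k.+1)) = f \o x.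
  by apply/funext => k; rewrite (proj1 xy_AM).
have f_noninc := AM_objective_nonincreasing _ _ _ _ _ _ _ yminP xy_AM.
have lbPhi : has_lbound (range (fun p : X * Y => Phi p.1 p.2)).
  by exists 0 => _ [p _ <-].
rewrite fxE; split => //.
- exact: (proj2 fh).
(* Class membership concerns every run [u], not just [x], so the certificate is built again from
   [u]. *)
- split=> // u [v [uv_AM uv_3pp]]; exists (fun k z => d z (u k.-1)).
  exact: AM_SUMMA2_certificate yminP uv_AM uv_3pp.
- by move=> k; rewrite (proj1 xy_AM).
- rewrite /beta -(inf_range_AM_objective _ _ _ _ ymin X_nonempty lbPhi yminP).
  apply: SUMMA2_certificate_cvg fh _ f_noninc.
  by exists 0 => _ [z _ <-]; apply: Phi_ge0.
Qed.
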